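(* Let $\mathcal{A}$ be a free (central) hyperplane arrangement in $\mathbb{K}^l$, and let $J(\mathcal{A})\subseteq S=\mathbb{K}[x_1,\dots,x_l]$ be its Jacobian ideal. Then $S/J(\mathcal{A})$ has the strong Lefschetz property.
   Context: $\mathbb{K}$ is a field of characteristic $0$ and $S=\mathbb{K}[x_1,\dots,x_l]$ has the standard grading. A central hyperplane arrangement is a finite set $\mathcal{A}=\{H_1,\dots,H_n\}$ of hyperplanes in $\mathbb{K}^l$ all containing the origin; for each $i$ fix a linear form $\alpha_i\in S$ with $H_i=\alpha_i^{-1}(0)$, and let $Q(\mathcal{A})=\prod_{i=1}^n\alpha_i$. The Jacobian ideal $J(\mathcal{A})$ is the ideal of $S$ generated by $Q(\mathcal{A})$ and all its partial derivatives. Let $\operatorname{Der}_{\mathbb{K}^l}=\{\sum_{i=1}^l f_i\partial_{x_i}\mid f_i\in S\}$ and $D(\mathcal{A})=\{\delta\in\operatorname{Der}_{\mathbb{K}^l}\mid \delta(\alpha_i)\in\alpha_iS\ \text{for all } i\}$. The central arrangement $\mathcal{A}$ is free if $D(\mathcal{A})$ is a free $S$-module. A graded ring $R=\bigoplus_{i\ge0}R_i$ over $\mathbb{K}$ with $\dim_{\mathbb{K}}R_i<\infty$ has the strong Lefschetz property if there exists $\ell\in R_1$ such that for all $i\ge0$ and $s\ge1$ the map $\times\ell^s\colon R_i\to R_{i+s}$ has full rank (is injective or surjective). *)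

(* Defs.v *)
From HB Require Import structures.
From mathcomp Require Import all_boot all_order all_algebra.
From mathcomp Require Import mpoly.
From mathcomp Require Import boolp.

Set Implicit Arguments.
Unset Strict Implicit.
Unset Printing Implicit Defensive.

Import GRing.Theory.

Local Open Scope ring_scope.
Local Open Scope quotient_scope.

Section GeneratedIdeal.
Variables (R : comPzRingType) (I : finType) (f : I -> R).

Definition gen_ideal : {pred R} :=
  fun x => `[< exists a : I -> R, x = \sum_t a t * f t >].

Lemma gen_idealP x :
  reflect (exists a : I -> R, x = \sum_t a t * f t) (x \in gen_ideal).
Proof. exact: asboolP. Qed.

Lemma gen_ideal_zmod_closed : zmod_closed gen_ideal.
Proof.
split=> [|x y /gen_idealP[a ->] /gen_idealP[b ->]]; apply/gen_idealP.
  by exists (fun=> 0); rewrite big1 // => t _; rewrite mul0r.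
exists (fun t => a t - b t); rewrite -sumrB.
by apply: eq_bigr => t _; rewrite mulrBl.
Qed.

HB.instance Definition _ :=
  GRing.isZmodClosed.Build R gen_ideal gen_ideal_zmod_closed.

Lemma gen_idealMl a x : x \in gen_ideal -> a * x \in gen_ideal.
Proof.
move=> /gen_idealP[b ->]; apply/gen_idealP; exists (fun t => a * b t).
by rewrite mulr_sumr; apply: eq_bigr => t _; rewrite mulrA.
Qed.

Lemma gen_idealMr a x : x \in gen_ideal -> x * a \in gen_ideal.
Proof. by rewrite mulrC; apply: gen_idealMl. Qed.

(* The ring structure that the library puts on [{ideal_quot I}] requires a
   proper ideal; the quotient below may be the zero ring. *)
Definition quot_ring : Type := {ideal_quot gen_ideal}.

HB.instance Definition _ := GRing.Zmodule.on quot_ring.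

Definition to_quot (x : R) : quot_ring := \pi_{ideal_quot gen_ideal} x.

Lemma to_quot_eq x y : to_quot x = to_quot y <-> x - y \in gen_ideal.
Proof.
rewrite Quotient.idealrBE; split; first by move=> e; apply/eqP.
by move/eqP.
Qed.

Lemma to_quot_surj (u : quot_ring) : exists x, u = to_quot x.
Proof.
by exists (repr (u : {ideal_quot gen_ideal})); rewrite /to_quot reprK.
Qed.

Lemma to_quot_is_zmod_morphism : zmod_morphism to_quot.
Proof. by move=> x y; rewrite /to_quot raddfB. Qed.

HB.instance Definition _ :=
  GRing.isZmodMorphism.Build R quot_ring to_quot to_quot_is_zmod_morphism.

Definition quot_one : quot_ring := to_quot 1.
Definition quot_mul (u v : {ideal_quot gen_ideal}) : quot_ring :=
  to_quot (repr u * repr v).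

Lemma to_quotM x y : to_quot (x * y) = quot_mul (to_quot x) (to_quot y).
Proof.
have reprE z : repr (to_quot z : {ideal_quot gen_ideal}) - z \in gen_ideal.
  by apply/to_quot_eq; rewrite /to_quot reprK.
apply/esym/to_quot_eq; set x' := repr _; set y' := repr _.
have -> : x' * y' - x * y = (x' - x) * y' + x * (y' - y).
  by rewrite mulrBl mulrBr addrA subrK.
by apply: rpredD; [apply: gen_idealMr | apply: gen_idealMl]; apply: reprE.
Qed.

Lemma quot_mulA : associative quot_mul.
Proof.
move=> u v w; have [x ->] := to_quot_surj u; have [y ->] := to_quot_surj v.
by have [z ->] := to_quot_surj w; rewrite -!to_quotM mulrA.
Qed.

Lemma quot_mulC : commutative quot_mul.
Proof.
move=> u v; have [x ->] := to_quot_surj u; have [y ->] := to_quot_surj v.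
by rewrite -!to_quotM mulrC.
Qed.

Lemma quot_mul1 : left_id quot_one quot_mul.
Proof. by move=> u; have [x ->] := to_quot_surj u; rewrite -to_quotM mul1r. Qed.

Lemma quot_mulDl : left_distributive quot_mul +%R.
Proof.
move=> u v w; have [x ->] := to_quot_surj u; have [y ->] := to_quot_surj v.
have [z ->] := to_quot_surj w.
by rewrite -raddfD -!to_quotM mulrDl raddfD.
Qed.

HB.instance Definition _ := GRing.Zmodule_isComPzRing.Build quot_ring
  quot_mulA quot_mulC quot_mul1 quot_mulDl.

Lemma to_quot_is_monoid_morphism : monoid_morphism to_quot.
Proof. by split=> // x y; rewrite to_quotM. Qed.

HB.instance Definition _ :=
  GRing.isMonoidMorphism.Build R quot_ring to_quot to_quot_is_monoid_morphism.

End GeneratedIdeal.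

(* A commutative graded ring over K with finite-dimensional pieces. The
   K-algebra structure is the ring morphism [scal]: algebras in the library's
   hierarchy are nonzero, and the zero ring must be allowed here. *)
Record graded_ring (K : fieldType) := GradedRing {
  carrier :> comPzRingType;
  scal : {rmorphism K -> carrier};
  piece : nat -> carrier -> Prop;
  piece0 : forall i, piece i 0;
  pieceD : forall i x y, piece i x -> piece i y -> piece i (x + y);
  pieceZ : forall i c x, piece i x -> piece i (scal c * x);
  piece1 : piece 0 1;
  pieceM : forall i j x y, piece i x -> piece j y -> piece (i + j) (x * y);
  piece_sum : forall x, exists (n : nat) (p : nat -> carrier),
    (forall i, piece i (p i)) /\ x = \sum_(i < n) p i;
  piece_direct : forall (n : nat) (p : nat -> carrier),
    (forall i, piece i (p i)) -> \sum_(i < n) p i = 0 ->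
    forall i, (i < n)%N -> p i = 0;
  piece_findim : forall i, exists (m : nat) (b : 'I_m -> carrier),
    forall x, piece i x -> exists c : 'I_m -> K, x = \sum_j scal (c j) * b j
}.

Arguments piece {K} R i x : rename.

Definition strong_lefschetz (K : fieldType) (R : graded_ring K) : Prop :=
  exists2 ell : R, piece R 1 ell &
    forall i s : nat, (1 <= s)%N ->
      (forall x y : R, piece R i x -> piece R i y ->
         ell ^+ s * x = ell ^+ s * y -> x = y)
      \/
      (forall z : R, piece R (i + s) z ->
         exists2 x : R, piece R i x & ell ^+ s * x = z).

Section HomogeneousQuotient.
Variables (K : fieldType) (l : nat) (I : finType) (f : I -> {mpoly K[l]}).
Hypothesis f_homog : forall t, exists d : nat, f t \is d.-homog.

Local Notation S := {mpoly K[l]}.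
Local Notation Q := (quot_ring f).
Local Notation pih d := (pihomog mdeg d).

Definition quot_scal (c : K) : Q := to_quot f c%:MP.

Lemma quot_scal_zmod_morphism : zmod_morphism quot_scal.
Proof. by move=> x y; rewrite /quot_scal !raddfB. Qed.

Lemma quot_scal_monoid_morphism : monoid_morphism quot_scal.
Proof. by split=> [|x y]; rewrite /quot_scal ?rmorph1 ?rmorphM. Qed.

HB.instance Definition _ :=
  GRing.isZmodMorphism.Build K Q quot_scal quot_scal_zmod_morphism.
HB.instance Definition _ :=
  GRing.isMonoidMorphism.Build K Q quot_scal quot_scal_monoid_morphism.

Definition quot_piece (i : nat) (u : Q) : Prop :=
  exists2 p : S, p \is i.-homog & u = to_quot f p.

Lemma quot_piece0 i : quot_piece i 0.
Proof. by exists 0; rewrite ?rpred0 ?raddf0. Qed.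

Lemma quot_pieceD i x y :
  quot_piece i x -> quot_piece i y -> quot_piece i (x + y).
Proof.
move=> [p hp ->] [q hq ->].
by exists (p + q); [rewrite rpredD | rewrite raddfD].
Qed.

Lemma quot_pieceZ i c x : quot_piece i x -> quot_piece i (quot_scal c * x).
Proof.
move=> [p hp ->]; exists (c *: p); first by rewrite rpredZ.
by rewrite /quot_scal -rmorphM /= mul_mpolyC.
Qed.

Lemma quot_piece1 : quot_piece 0 1.
Proof. by exists 1; [apply: dhomog1 | rewrite rmorph1]. Qed.

Lemma quot_pieceM i j x y :
  quot_piece i x -> quot_piece j y -> quot_piece (i + j) (x * y).
Proof.
move=> [p hp ->] [q hq ->].
by exists (p * q); [apply: dhomogM | rewrite rmorphM].
Qed.

Lemma quot_piece_sum x : exists (n : nat) (p : nat -> Q),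
  (forall i, quot_piece i (p i)) /\ x = \sum_(i < n) p i.
Proof.
have [p ->] := to_quot_surj x.
exists (mmeasure mdeg p), (fun i => to_quot f (pih i p)); split.
  by move=> i; exists (pih i p); rewrite ?pihomogP.
by rewrite {1}(pihomog_partitionE (leqnn (mmeasure mdeg p))) raddf_sum.
Qed.

Lemma gen_ideal_pihomog i p : p \in gen_ideal f -> pih i p \in gen_ideal f.
Proof.
move=> /gen_idealP[a ->]; rewrite raddf_sum /= rpred_sum // => t _.
have [d hd] := f_homog t.
rewrite (pihomog_partitionE (leqnn (mmeasure mdeg (a t)))) mulr_suml.
rewrite raddf_sum /= rpred_sum // => j _.
have hj : pih j (a t) * f t \is (j + d).-homog by rewrite dhomogM ?pihomogP.
have [e|ne] := eqVneq (j + d)%N i; last by rewrite (pihomog_ne0 ne hj) rpred0.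
rewrite e in hj; rewrite (pihomog_dE hj); apply: gen_idealMl.
apply/gen_idealP; exists (fun s => (s == t)%:R).
rewrite (bigD1 t) //= eqxx mul1r big1 ?addr0 // => s /negPf ->.
by rewrite mul0r.
Qed.

Lemma quot_piece_direct (n : nat) (p : nat -> Q) :
  (forall i, quot_piece i (p i)) -> \sum_(i < n) p i = 0 ->
  forall i, (i < n)%N -> p i = 0.
Proof.
move=> hp s0 i lt_in.
have /choice[q hq] : forall j, exists q : S, q \is j.-homog /\ p j = to_quot f q.
  by move=> j; have [q] := hp j; exists q.
have : to_quot f (\sum_(j < n) q j) = to_quot f 0.
  rewrite raddf_sum raddf0 -[RHS]s0; apply: eq_bigr => j _.
  by have [_ ->] := hq j.
move/to_quot_eq; rewrite subr0 => /(gen_ideal_pihomog i).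
rewrite raddf_sum /= (bigD1 (Ordinal lt_in)) //= big1 ?addr0 => [|j ne].
  have [hi ->] := hq i; rewrite (pihomog_dE hi) => hI.
  by rewrite -(raddf0 (to_quot f)); apply/to_quot_eq; rewrite subr0.
have [hj _] := hq j; rewrite (pihomog_ne0 _ hj) //.
Qed.

Lemma quot_piece_findim i : exists (m : nat) (b : 'I_m -> Q),
  forall x, quot_piece i x ->
    exists c : 'I_m -> K, x = \sum_j quot_scal (c j) * b j.
Proof.
pose T : finType := 'X_{1..l < i.+1}.
exists #|T|, (fun j => to_quot f 'X_[enum_val j : T]) => _ [p hp ->].
exists (fun j => p@_(enum_val j : T)).
have hs : (msize p <= i.+1)%N.
  rewrite msizeE; apply/bigmax_leqP_seq => m m_p _.
  by rewrite ltnS (dhomog_mf hp m_p).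
rewrite {1}(mpolywE hs) raddf_sum /=.
rewrite (reindex (@enum_val T T)) /=; last exact/onW_bij/enum_val_bij.
apply: eq_bigr => j _.
by rewrite /quot_scal -rmorphM /= mul_mpolyC.
Qed.

Definition homog_quotient : graded_ring K :=
  @GradedRing K Q quot_scal quot_piece quot_piece0 quot_pieceD quot_pieceZ
    quot_piece1 quot_pieceM quot_piece_sum quot_piece_direct quot_piece_findim.

End HomogeneousQuotient.

(* A central arrangement of [num] hyperplanes, that is, distinct linear
   subspaces of codimension 1, each with a chosen linear form defining it. *)
Record arrangement (K : fieldType) (l : nat) := Arrangement {
  num : nat;
  hyp : 'I_num -> {vspace 'rV[K]_l};
  hyp_inj : injective hyp;
  hyp_codim : forall i, (\dim (hyp i)).+1 = l;
  form : 'I_num -> {mpoly K[l]};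
  form_linear : forall i, form i \is 1.-homog;
  form_zeros : forall (i : 'I_num) (v : 'rV[K]_l),
    v \in hyp i <-> (form i).@[fun j => v 0 j] = 0
}.

Section Arrangement.
Variables (K : fieldType) (l : nat) (A : arrangement K l).
Local Notation S := {mpoly K[l]}.

Definition defining_poly : S := \prod_(i < num A) form i.

(* [None] gives Q(A) and [Some i] its i-th partial derivative. *)
Definition jacobian_gens (o : option 'I_l) : S :=
  if o is Some i then defining_poly^`M(i) else defining_poly.

Lemma defining_poly_homog : defining_poly \is (num A).-homog.
Proof.
suff : defining_poly \is (\sum_(i < num A) 1).-homog.
  by rewrite sum_nat_const card_ord muln1.
rewrite /defining_poly.
apply: (big_rec2 (fun (d : nat) (p : S) => p \is d.-homog)); first exact: dhomog1.
by move=> i d p _ hp; rewrite dhomogM ?form_linear.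
Qed.

Lemma jacobian_gens_homog o : exists d : nat, jacobian_gens o \is d.-homog.
Proof.
case: o => [i|] /=; last by exists (num A); apply: defining_poly_homog.
exists (num A).-1; apply/dhomogP => m; rewrite mcoeff_msupp mcoeff_deriv.
move=> nz; have /dhomog_mf hQ := defining_poly_homog.
have /hQ : (m + U_(i))%MM \in msupp defining_poly.
  by rewrite mcoeff_msupp; apply: contra_neq nz => ->; rewrite mul0rn.
by rewrite /= mdegD mdeg1 addn1 => <-.
Qed.

(* S/J(A) *)
Definition jacobian_quotient : graded_ring K :=
  homog_quotient jacobian_gens_homog.

(* The row (f_1, ..., f_l) stands for the derivation \sum_i f_i d/dx_i. *)
Definition der_apply (delta : 'rV[S]_l) (p : S) : S :=
  \sum_(i < l) delta 0 i * p^`M(i).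

Definition log_der (delta : 'rV[S]_l) : Prop :=
  forall i : 'I_(num A), exists g : S, der_apply delta (form i) = form i * g.

End Arrangement.

(* The submodule N of M has a basis (B may be infinite). *)
Definition free_submodule (R : comNzRingType) (M : lmodType R)
    (N : M -> Prop) : Prop :=
  exists B : M -> Prop,
    [/\ forall b, B b -> N b,
        forall x, N x -> exists (n : nat) (b : 'I_n -> M) (c : 'I_n -> R),
          (forall i, B (b i)) /\ x = \sum_i c i *: b i
      & forall (n : nat) (b : 'I_n -> M) (c : 'I_n -> R),
          injective b -> (forall i, B (b i)) ->
          \sum_i c i *: b i = 0 -> forall i, c i = 0].

Definition free_arrangement (K : fieldType) (l : nat) (A : arrangement K l) :=
  free_submodule (@log_der K l A).

(* Main.v *)
Require Import Defs.
From mathcomp Require Import all_boot all_order all_algebra.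
From mathcomp Require Import mpoly ring.
From mathcomp Require Import boolp.

Set Implicit Arguments.
Unset Strict Implicit.
Unset Printing Implicit Defensive.

Import GRing.Theory.
Local Open Scope ring_scope.

(** Write S = K[x_1, ..., x_l], Q for the defining polynomial, J for the
    Jacobian ideal and a_i for the linear forms of the arrangement.

    If l >= 3, multiplication by a suitable linear form ell is injective on
    S / J, so that only the injective half of the full-rank alternative
    occurs.  Take ell outside every span of two of the a_i, and a constant
    derivation v with v(a_i) != 0 for all i; put P = v(Q), an element of J.
    Then P is a nonzerodivisor modulo (ell, Q): modulo the prime (ell, a_i) it
    is a nonzero scalar multiple of the product of the a_j with j != i.  Suppose
    that ell f = a(Q) + Q g for some derivation a.  The syzygy
      P (Q a) = Q (P a - ell f v) + ell (Q f v)
    holds between logarithmic derivations, since these are exactly the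
    derivations d such that Q divides d(Q).  As the module of logarithmic
    derivations is free, P is a nonzerodivisor on it modulo (ell, Q), hence
    Q a = Q y + ell z with y logarithmic.  So a - y = ell c for a derivation
    c, and ell (f - c(Q)) is a multiple of Q; then so is f - c(Q), and f lies
    in J ([jacobian_regular]).  This is the depth argument behind the
    Auslander-Buchsbaum formula, done by hand on one Koszul complex.

    If l <= 1, the arrangement has at most one hyperplane, and J = S.

    If l = 2, any two distinct a_i, a_j generate the ideal (x_1, x_2);
    multiplying these relations together shows that J contains all forms of
    large degree ([jacobian_in_radical]).  Every homogeneous ideal with this
    property has a quotient with the strong Lefschetz property
    ([strong_lefschetz_binary_forms]), as follows.  Dehomogenize, with ell = x_1 - t x_2 becoming X - t, and let V be the
    space of polynomials corresponding to the forms of degree i + s in J, of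
    dimension k.  By a Wronskian argument in characteristic 0, for almost all
    t no nonzero element of V vanishes at t to order k.  Hence V has all jets
    of order k at t, by comparing dimensions.  For s >= k this makes
    multiplication by ell^s injective in degree i, for s <= k surjective onto
    degree i + s; only finitely many degrees constrain t. *)

(** * Points avoiding finitely many conditions *)

Lemma natr_eq0_pchar0 (K : fieldType) (charK0 : [pchar K] =i pred0) (n : nat) :
  (n%:R == 0 :> K) = (n == 0)%N.
Proof. by move/pcharf0P: charK0 => ->. Qed.

Lemma exists_nonroot (K : fieldType) (charK0 : [pchar K] =i pred0)
  (p : {poly K}) : p != 0 -> exists t, p.[t] != 0.
Proof.
move=> p0; pose rs := [seq (i%:R : K) | i <- iota 0 (size p)].
have urs : uniq rs.
  rewrite map_inj_in_uniq ?iota_uniq // => i j _ _.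
  wlog le_ij : i j / (i <= j)%N.
    by move=> W; case: (leqP i j) => [/W//|/ltnW /W H /esym /H].
  move=> e; apply/eqP; rewrite eqn_leq le_ij /= -subn_eq0.
  by rewrite -(natr_eq0_pchar0 charK0) natrB // e subrr.
have [/(max_poly_roots p0)/(_ urs)|] := boolP (all (root p) rs).
  by rewrite size_map size_iota ltnn.
by rewrite -has_predC => /hasP[t _]; exists t.
Qed.

(** Finitely many nonzero linear functionals on K^l have a common point of
    nonvanishing, found on the moment curve (1, t, t^2, ...). *)
Lemma exists_row_nonvanishing (K : fieldType) (charK0 : [pchar K] =i pred0)
  (l : nat) (I : finType) (c : I -> 'cV[K]_l) :
  (forall i, c i != 0) -> exists w : 'rV[K]_l, forall i, w *m c i != 0.
Proof.
move=> c0; pose p i : {poly K} := rVpoly (c i)^T.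
have p0 : \prod_i p i != 0.
  rewrite prodf_seq_neq0; apply/allP => i _; apply: contra (c0 i) => /eqP e.
  by rewrite -trmx_eq0 -[_^T]rVpolyK -/(p i) e linear0.
have [t] := exists_nonroot charK0 p0.
rewrite horner_prod prodf_seq_neq0 => /allP ht.
exists (\row_j t ^+ j) => i; have := ht i (mem_index_enum _); rewrite /=.
apply: contra => /eqP /(congr1 (fun M : 'M_1 => M 0 0)); rewrite !mxE => e.
rewrite horner_poly -[X in _ == X]e; apply/eqP/eq_bigr => j _.
rewrite mxE; case: insubP => [u _ /val_inj ->|]; last by rewrite ltn_ord.
by rewrite !mxE mulrC.
Qed.

Lemma exists_row_notin (K : fieldType) (charK0 : [pchar K] =i pred0)
  (l m : nat) (I : finType) (U : I -> 'M[K]_(m, l)) :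
  (m < l)%N -> exists w : 'rV[K]_l, forall i, ~~ (w <= U i)%MS.
Proof.
move=> lt_ml.
have ex i : exists c : 'cV[K]_l, (c != 0) && (U i *m c == 0).
  have /matrix0Pn[a [b Hab]] : cokermx (U i) != 0.
    rewrite -mxrank_eq0 mxrank_coker subn_eq0 -ltnNge.
    exact: leq_ltn_trans (rank_leq_row _) lt_ml.
  exists (col b (cokermx (U i))); apply/andP; split.
    apply: contra Hab => /eqP/matrixP/(_ a 0); rewrite !mxE => ->; exact: eqxx.
  by rewrite colE mulmxA mulmx_coker mul0mx.
have [w hw] :=
  exists_row_nonvanishing charK0 (fun i => proj1 (andP (xchooseP (ex i)))).
exists w => i; apply: contra (hw i) => /submxP[D ->].
by case/andP: (xchooseP (ex i)) => _ /eqP e; rewrite -mulmxA e mulmx0.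
Qed.

(** Every linear subspace, given as a predicate, is the row space of a matrix:
    one of maximal rank among those with rows in the subspace. *)
Lemma exists_row_space (K : fieldType) (n : nat) (V : 'rV[K]_n -> Prop) :
  V 0 -> (forall u v, V u -> V v -> V (u + v)) ->
  (forall (c : K) u, V u -> V (c *: u)) ->
  exists A : 'M[K]_n, forall u, V u <-> (u <= A)%MS.
Proof.
move=> V0 VD VZ.
have Vsum (m : nat) (c : 'rV[K]_m) (A : 'M_(m, n)) :
    (forall i, V (row i A)) -> V (c *m A).
  by move=> VA; rewrite mulmx_sum_row; elim/big_ind: _ => // i _; apply: VZ.
pose P r := `[< exists A : 'M[K]_n, (forall i, V (row i A)) /\ \rank A = r >].
have exP : exists r, P r.
  by exists 0%N; apply/asboolP; exists 0; rewrite mxrank0; split=> // i; rewrite row0.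
have ubP r : P r -> (r <= n)%N by move=> /asboolP[A [_ <-]]; apply: rank_leq_row.
have [r /asboolP[A [VA rA]] max_r] := ex_maxnP exP ubP.
have sub_V u : (u <= A)%MS -> V u by move/submxP => [D ->]; apply: Vsum.
exists A => u; split=> [Vu|]; last exact: sub_V.
apply: contrapT => /negP nuA.
have VB i : V (row i (A + u)%MS).
  have /sub_addsmxP[[c d] /= ->] := row_sub i (A + u)%MS.
  by apply: VD; [apply: Vsum | apply: Vsum => j; rewrite row_id].
have /max_r : P (\rank (A + u)) by apply/asboolP; exists (A + u)%MS.
rewrite -rA leqNgt rank_ltmx // /ltmx addsmxSl /=.
by apply: contra nuA; apply: submx_trans (addsmxSr _ _).
Qed.

(** * Orders of vanishing in a space of polynomials *)

Lemma deriv_eq0_pchar0 (K : fieldType) (charK0 : [pchar K] =i pred0)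
  (p : {poly K}) : p^`() = 0 -> exists c, p = c%:P.
Proof.
move=> /polyP dp; exists p`_0; apply/polyP => -[|i]; rewrite coefC //=.
move/eqP: (dp i); rewrite coef_deriv coef0 -mulr_natr mulf_eq0.
by rewrite natr_eq0_pchar0 // orbF => /eqP.
Qed.

Lemma dvdp_deriv_pchar0 (K : fieldType) (charK0 : [pchar K] =i pred0)
  (p : {poly K}) : p != 0 -> p %| p^`() -> exists c, p = c%:P.
Proof.
move=> p0 dvd; apply: (deriv_eq0_pchar0 charK0); apply: contrapT => /eqP dp0.
by have := leq_trans (lt_size_deriv p0) (dvdp_leq dp0 dvd); rewrite ltnn.
Qed.

(** Dividing out the gcd makes g and h coprime; each then divides its own
    derivative, hence is constant. *)
Lemma wronskian2_eq0 (K : fieldType) (charK0 : [pchar K] =i pred0)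
  (g h : {poly K}) :
  h != 0 -> g^`() * h = g * h^`() -> exists c, g = c *: h.
Proof.
move=> h0 e; have [->|g0] := eqVneq g 0; first by exists 0; rewrite scale0r.
pose d := gcdp g h.
have d0 : d != 0 by rewrite gcdp_eq0 negb_and g0.
have [dg dh] : g = g %/ d * d /\ h = h %/ d * d.
  by rewrite !divpK ?dvdp_gcdl ?dvdp_gcdr.
have cop : coprimep (g %/ d) (h %/ d) by rewrite coprimep_div_gcd ?g0.
move: cop dg dh; set g1 := g %/ d; set h1 := h %/ d => cop dg dh.
have g10 : g1 != 0 by apply: contraNneq g0 => z; rewrite dg z mul0r.
have h10 : h1 != 0 by apply: contraNneq h0 => z; rewrite dh z mul0r.
have {}e : g1^`() * h1 = g1 * h1^`().
  have : (g1^`() * h1 - g1 * h1^`()) * (d * d) = 0.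
    move/eqP: e; rewrite dg dh !derivM -subr_eq0 => /eqP <-; ring.
  by move/eqP; rewrite mulf_eq0 mulf_eq0 (negPf d0) !orbF subr_eq0 => /eqP.
have [a ga] : exists c, g1 = c%:P.
  by apply: dvdp_deriv_pchar0 => //; rewrite -(Gauss_dvdpl _ cop) e dvdp_mulr.
have [b hb] : exists c, h1 = c%:P.
  apply: dvdp_deriv_pchar0 => //.
  by rewrite -(Gauss_dvdpr _ (_ : coprimep h1 g1)) 1?coprimep_sym // -e dvdp_mull.
have b0 : b != 0 by apply: contraNneq h10; rewrite hb => ->.
exists (a / b); rewrite dg dh ga hb !mul_polyC scalerA divfK //.
Qed.

Lemma exp_dvdp_deriv (K : fieldType) (q p : {poly K}) (k : nat) :
  q ^+ k.+1 %| p -> q ^+ k %| p^`().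
Proof.
move=> /dvdpP[r ->]; rewrite derivM deriv_exp dvdp_add //.
  by rewrite exprS mulrA dvdp_mull.
by rewrite -mulr_natl !mulrA dvdp_mull.
Qed.

(** A nontrivial combination of k independent polynomials vanishes at t to
    order at least k only if t is a zero of W, which plays the role of their
    Wronskian.  Induction on k: if f is the sum of the c_a v_a, then
    v_0^2 (f / v_0)' is the sum of the c_a (v_a' v_0 - v_a v_0') over a > 0.
    The polynomials v_a' v_0 - v_a v_0' are independent by [wronskian2_eq0],
    and at most one order of vanishing at t is lost. *)
Lemma generic_vanishing_order (K : fieldType) (charK0 : [pchar K] =i pred0)
  (k : nat) (v : 'I_k -> {poly K}) :
  (forall c, \sum_a c a *: v a = 0 -> forall a, c a = 0) ->
  exists2 W : {poly K}, W != 0 &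
    forall t, W.[t] != 0 -> forall c,
      ('X - t%:P) ^+ k %| \sum_a c a *: v a -> forall a, c a = 0.
Proof.
elim: k v => [|k IH] v free_v; first by exists 1; rewrite ?oner_eq0 // => ? _ ? _ [].
pose h := v ord0; pose u a := (v (lift ord0 a))^`() * h - v (lift ord0 a) * h^`().
have h0 : h != 0.
  apply/eqP => h0; suff /eqP : (ord0 == ord0 :> 'I_k.+1)%:R = 0 :> K.
    by rewrite eqxx oner_eq0.
  apply: (free_v (fun a => (a == ord0)%:R)).
  rewrite big_ord_recl big1 ?addr0 /= => [|a _]; last by rewrite scale0r.
  by rewrite -/h h0 scaler0.
have sumu (c : 'I_k.+1 -> K) : \sum_a c (lift ord0 a) *: u a =
    (\sum_a c a *: v a)^`() * h - (\sum_a c a *: v a) * h^`().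
  rewrite big_ord_recl -/h derivD derivZ raddf_sum /=.
  rewrite !mulrDl opprD addrACA -!scalerAl [h * _]mulrC subrr add0r.
  rewrite !mulr_suml -sumrB; apply: eq_bigr => a _.
  by rewrite derivZ scalerBr !scalerAl.
have free_u c : \sum_a c a *: u a = 0 -> forall a, c a = 0.
  move=> c0 a; pose c1 i := if unlift ord0 i is Some j then c j else 0.
  have c1E j : c1 (lift ord0 j) = c j by rewrite /c1 liftK.
  have := sumu c1; under eq_bigr do rewrite c1E.
  rewrite c0 => /esym/eqP; rewrite subr_eq0 => /eqP /(wronskian2_eq0 charK0 h0)[b].
  move/eqP; rewrite -subr_eq0 => /eqP e.
  pose c2 i := if unlift ord0 i is Some j then c j else - b.
  have -> : c a = c2 (lift ord0 a) by rewrite /c2 liftK.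
  apply: free_v; rewrite -[RHS]e !big_ord_recl /c1 /c2 unlift_none -/h.
  rewrite scale0r add0r scaleNr addrC; congr (_ - _).
  by apply: eq_bigr => j _; rewrite liftK.
have [W W0 HW] := IH u free_u.
exists (h * W); first by rewrite mulf_neq0.
move=> t; rewrite hornerM mulf_eq0 negb_or => /andP[ht /HW{}HW] c dvd.
have c0 : forall a, c (lift ord0 a) = 0.
  apply: HW; rewrite sumu dvdp_sub //; first by rewrite dvdp_mulr // exp_dvdp_deriv.
  by rewrite dvdp_mulr // (dvdp_trans _ dvd) // dvdp_exp2l.
have c00 : c ord0 = 0.
  have : root (\sum_a c a *: v a) t.
    by rewrite root_factor_theorem (dvdp_trans _ dvd) // exprS dvdp_mulr.
  rewrite big_ord_recl big1 => [|a _]; last by rewrite c0 scale0r.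
  by rewrite addr0 rootE hornerZ mulf_eq0 (negPf ht) orbF => /eqP.
by move=> a; case: (unliftP ord0 a) => [j ->|->].
Qed.

Lemma XsubC_exp_dvdp (K : fieldType) (t : K) (k : nat) (p : {poly K}) :
  (forall j, (j < k)%N -> (p \Po ('X + t%:P))`_j = 0) -> ('X - t%:P) ^+ k %| p.
Proof.
move=> H; have e : p \Po ('X + t%:P) = drop_poly k (p \Po ('X + t%:P)) * 'X^k.
  rewrite -[LHS](poly_take_drop k) [take_poly _ _](_ : _ = 0) ?add0r //.
  by apply/polyP => j; rewrite coef_take_poly coef0; case: ifP => // /H.
have -> : p = (p \Po ('X + t%:P)) \Po ('X - t%:P).
  by rewrite -comp_polyA comp_polyD comp_polyX comp_polyC subrK comp_polyXr.
by rewrite e comp_polyM rmorphXn /= comp_polyX dvdp_mull.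
Qed.

(** A space V of polynomials of bounded degree has, at all but finitely many points t, the
    following property: for every order s, either no nonzero element of V
    vanishes at t to order s, or every jet of order s at t is the jet of an
    element of V.  The threshold between the two cases is the dimension of
    V. *)
Lemma generic_jets (K : fieldType) (charK0 : [pchar K] =i pred0) (n : nat)
  (V : {poly K} -> Prop) :
  V 0 -> (forall p q, V p -> V q -> V (p + q)) ->
  (forall (c : K) p, V p -> V (c *: p)) ->
  (forall p, V p -> (size p <= n)%N) ->
  exists2 W : {poly K}, W != 0 & forall t, W.[t] != 0 -> forall s,
    (forall p, V p -> ('X - t%:P) ^+ s %| p -> p = 0) \/
    (forall q, exists2 p, V p & ('X - t%:P) ^+ s %| q - p).
Proof.
move=> V0 VD VZ Vn.
have [A VA] : exists A : 'M[K]_n, forall u, V (rVpoly u) <-> (u <= A)%MS.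
  apply: (@exists_row_space K n (fun u => V (rVpoly u))); first by rewrite linear0.
    by move=> u v Vu Vv; rewrite linearD; apply: VD.
  by move=> c u Vu; rewrite linearZ; apply: VZ.
pose k := \rank A; pose v (a : 'I_k) := rVpoly (row a (row_base A)).
have vE (D : 'rV_k) : \sum_a D 0 a *: v a = rVpoly (D *m row_base A).
  by rewrite mulmx_sum_row linear_sum; apply: eq_bigr => a _; rewrite linearZ.
have Vv (D : 'rV_k) : V (rVpoly (D *m row_base A)).
  by apply/VA; rewrite (submx_trans (submxMl _ _)) // eq_row_base.
have free_v c : \sum_a c a *: v a = 0 -> forall a, c a = 0.
  move=> c0 a; have := vE (\row_i c i); under eq_bigr do rewrite mxE.
  rewrite c0 => /esym e.
  have : (\row_i c i) *m row_base A = 0 *m row_base A.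
    by rewrite mul0mx -[LHS]rVpolyK e linear0.
  by move/(row_free_inj (row_base_free A))/rowP/(_ a); rewrite !mxE.
have [W W0 HW] := generic_vanishing_order charK0 free_v.
exists W => // t /HW{}HW s.
have HW0 (D : 'rV_k) : ('X - t%:P) ^+ k %| rVpoly (D *m row_base A) -> D = 0.
  by rewrite -vE => /HW D0; apply/rowP => a; rewrite D0 mxE.
have [le_ks|lt_sk] := leqP k s; [left=> p Vp dvd|right=> q].
  have pE : rVpoly (poly_rV p : 'rV_n) = p by rewrite poly_rV_K // Vn.
  have := Vp; rewrite -pE => /VA; rewrite -(eq_row_base A) => /submxP[D eD].
  have dvd' : ('X - t%:P) ^+ k %| p by rewrite (dvdp_trans _ dvd) // dvdp_exp2l.
  by rewrite -pE eD in dvd'; rewrite eD (HW0 _ dvd') mul0mx linear0.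
pose jet (p : {poly K}) : 'rV_k := \row_j (p \Po ('X + t%:P))`_j.
have jet_eq0 p : jet p = 0 -> ('X - t%:P) ^+ k %| p.
  move=> /rowP e; apply: XsubC_exp_dvdp => j lt_jk.
  by have := e (Ordinal lt_jk); rewrite !mxE.
(* No nontrivial combination of the basis has a zero jet of order k, so the
   square matrix of the jets of the basis is invertible. *)
pose M : 'M_k := \matrix_a jet (v a).
have jetE (D : 'rV_k) : jet (rVpoly (D *m row_base A)) = D *m M.
  apply/rowP => j; rewrite -vE !mxE linear_sum coef_sum.
  by apply: eq_bigr => a _; rewrite linearZ coefZ !mxE.
have uM : M \in unitmx.
  rewrite -row_free_unit -kermx_eq0; apply/eqP/row_matrixP => a; rewrite row0.
  by apply: HW0; apply: jet_eq0; rewrite jetE -row_mul mulmx_ker row0.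
pose D := jet q *m invmx M.
exists (rVpoly (D *m row_base A)); first exact: Vv.
rewrite (@dvdp_trans _ (('X - t%:P) ^+ k)) ?dvdp_exp2l 1?ltnW //.
apply: jet_eq0; transitivity (jet q - jet (rVpoly (D *m row_base A))).
  by apply/rowP => j; rewrite !mxE linearB coefB.
by rewrite jetE mulmxKV // subrr.
Qed.

(** * Binary forms *)

(** The substitution x_1 = X, x_2 = 1. *)
Definition dehomogenize (K : fieldType) : {mpoly K[2]} -> {poly K} :=
  mmap (@polyC K) (fun i : 'I_2 => if i == 0 then 'X else 1).

(** The binary form of degree d that dehomogenizes to p, for p of degree at
    most d; higher terms of p are dropped. *)
Definition homogenize (K : fieldType) (d : nat) (p : {poly K}) : {mpoly K[2]} :=
  \sum_(i < d.+1) p`_i *: ('X_0 ^+ i * 'X_1 ^+ (d - i)).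

Section Dehomogenize.
Variable K : fieldType.
Implicit Types (F G : {mpoly K[2]}) (p q : {poly K}) (d : nat).

Lemma dehomogenizeD F G : dehomogenize (F + G) = dehomogenize F + dehomogenize G.
Proof. exact: mmapD. Qed.

Lemma dehomogenizeB F G : dehomogenize (F - G) = dehomogenize F - dehomogenize G.
Proof. exact: mmapB. Qed.

Lemma dehomogenizeZ c F : dehomogenize (c *: F) = c *: dehomogenize F.
Proof. by rewrite /dehomogenize mmapZ mul_polyC. Qed.

Lemma dehomogenizeM F G : dehomogenize (F * G) = dehomogenize F * dehomogenize G.
Proof. exact: rmorphM. Qed.

Lemma dehomogenizeXn F n : dehomogenize (F ^+ n) = dehomogenize F ^+ n.
Proof. exact: rmorphXn. Qed.

Lemma dehomogenizeX m : dehomogenize ('X_[m] : {mpoly K[2]}) = 'X^(m ord0).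
Proof.
rewrite /dehomogenize mmapX /mmap1 big_ord_recl big_ord1 /=.
by rewrite expr1n mulr1.
Qed.

Lemma dehomogenizeE F : dehomogenize F = \sum_(m <- msupp F) F@_m *: 'X^(m ord0).
Proof.
rewrite {1}[F]mpolyE /dehomogenize raddf_sum; apply: eq_bigr => m _ /=.
by rewrite -/(dehomogenize _) dehomogenizeZ dehomogenizeX.
Qed.

Lemma dhomog2_mdeg d F m : F \is d.-homog -> m \in msupp F ->
  (m ord0 + m (lift ord0 ord0))%N = d.
Proof. by move/dhomog_mf => H /H <-; rewrite /= mdegE big_ord_recl big_ord1. Qed.

Lemma size_dehomogenize d F : F \is d.-homog -> (size (dehomogenize F) <= d.+1)%N.
Proof.
move=> hF; rewrite dehomogenizeE (leq_trans (size_sum _ _ _)) //.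
rewrite big_seq; apply/bigmax_leqP_seq => m _ hm.
rewrite (leq_trans (size_scale_leq _ _)) // size_polyXn ltnS.
by rewrite -(dhomog2_mdeg hF hm) leq_addr.
Qed.

Lemma homogenize_homog d p : homogenize d p \is d.-homog.
Proof.
rewrite rpred_sum // => i _; rewrite rpredZ //.
have := leq_ord i; move: (nat_of_ord i) => {}i /subnKC {2}<-.
by rewrite dhomogM // -[X in X.-homog]mul1n dhomogMn // dhomogX /= mdeg1.
Qed.

Lemma homogenizeK d p : (size p <= d.+1)%N -> dehomogenize (homogenize d p) = p.
Proof.
move=> sp; rewrite /homogenize /dehomogenize raddf_sum /=.
transitivity (\sum_(i < d.+1) p`_i *: 'X^i); last first.
  by rewrite -poly_def; apply/polyP => i; rewrite coef_poly; case: ltnP => // h;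
     rewrite nth_default // (leq_trans sp).
apply: eq_bigr => i _; rewrite -/(dehomogenize _) dehomogenizeZ dehomogenizeM.
by rewrite !dehomogenizeXn !dehomogenizeX !mnm1E /= expr0 expr1 expr1n mulr1.
Qed.

Lemma homogenizeD d p q : homogenize d (p + q) = homogenize d p + homogenize d q.
Proof. by rewrite -big_split; apply: eq_bigr => i _; rewrite coefD scalerDl. Qed.

Lemma homogenizeZ d c p : homogenize d (c *: p) = c *: homogenize d p.
Proof. by rewrite scaler_sumr; apply: eq_bigr => i _; rewrite coefZ scalerA. Qed.

Lemma dehomogenizeK d F : F \is d.-homog -> homogenize d (dehomogenize F) = F.
Proof.
move=> hF; rewrite [in RHS](mpolyE F) dehomogenizeE big_seq [RHS]big_seq.
elim/big_ind2: _ => [|p G q H <- <-|m hm].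
- by rewrite /homogenize big1 // => i _; rewrite coef0 scale0r.
- exact: homogenizeD.
have md := dhomog2_mdeg hF hm; rewrite homogenizeZ; congr (_ *: _).
have lt_m : (m ord0 < d.+1)%N by rewrite ltnS -md leq_addr.
rewrite /homogenize (bigD1 (Ordinal lt_m)) //= coefXn eqxx scale1r big1 ?addr0.
  have e1 : lift ord0 ord0 = 1 :> 'I_2 by apply: val_inj.
  by rewrite [RHS]mpolyXE_id big_ord_recl big_ord1 -md addKn e1.
by move=> i /negPf ne; rewrite coefXn [_ == _](_ : _ = false) ?scale0r.
Qed.

Lemma dehomogenize_inj d F G : F \is d.-homog -> G \is d.-homog ->
  dehomogenize F = dehomogenize G -> F = G.
Proof. by move=> hF hG e; rewrite -(dehomogenizeK hF) e dehomogenizeK. Qed.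

End Dehomogenize.

(** * The strong Lefschetz property in two variables *)

(** The strong Lefschetz property of a quotient, expressed on
    representatives. *)
Lemma strong_lefschetz_homog_quotient (K : fieldType) (l : nat) (I : finType)
  (f : I -> {mpoly K[l]}) (f_homog : forall t, exists d : nat, f t \is d.-homog)
  (ell : {mpoly K[l]}) :
  ell \is 1.-homog ->
  (forall i s : nat, (1 <= s)%N ->
    (forall F, F \is i.-homog -> ell ^+ s * F \in gen_ideal f ->
       F \in gen_ideal f)
    \/
    (forall G, G \is (i + s).-homog ->
       exists2 F, F \is i.-homog & G - ell ^+ s * F \in gen_ideal f)) ->
  strong_lefschetz (homog_quotient f_homog).
Proof.
move=> hell H; exists (to_quot f ell); first by exists ell.
move=> i s /(H i)[inj|surj]; [left|right].
  move=> _ _ [F hF ->] [G hG ->]; rewrite -!rmorphXn -!rmorphM /=.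
  move=> /to_quot_eq e; apply/to_quot_eq; apply: inj; first by rewrite rpredB.
  by rewrite mulrBr.
move=> _ [G hG ->]; have [F hF e] := surj G hG.
exists (to_quot f F); first by exists F.
rewrite -rmorphXn -rmorphM /=; apply/esym/to_quot_eq; exact: e.
Qed.

Lemma strong_lefschetz_binary_forms (K : fieldType)
  (charK0 : [pchar K] =i pred0) (I : finType) (f : I -> {mpoly K[2]})
  (f_homog : forall t, exists d : nat, f t \is d.-homog) (N : nat) :
  (forall d F, (N <= d)%N -> F \is d.-homog -> F \in gen_ideal f) ->
  strong_lefschetz (homog_quotient f_homog).
Proof.
move=> artinian.
(* V d is the space of dehomogenized forms of degree d of the ideal. *)
pose V d p := exists F, [/\ F \is d.-homog, F \in gen_ideal f & dehomogenize F = p].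
have jets d : exists2 W : {poly K}, W != 0 & forall t, W.[t] != 0 -> forall s,
    (forall p, V d p -> ('X - t%:P) ^+ s %| p -> p = 0) \/
    (forall q, exists2 p, V d p & ('X - t%:P) ^+ s %| q - p).
  apply: (@generic_jets K charK0 d.+1).
  - by exists 0; rewrite !rpred0; split=> //; rewrite /dehomogenize mmap0.
  - move=> p q [F [hF JF <-]] [G [hG JG <-]]; exists (F + G).
    by rewrite !rpredD // dehomogenizeD.
  - move=> c p [F [hF JF <-]]; exists (c *: F).
    by rewrite rpredZ // dehomogenizeZ -mul_mpolyC gen_idealMl.
  - by move=> p [F [hF _ <-]]; apply: size_dehomogenize.
have /choice[W HW] : forall d, exists W : {poly K}, W != 0 /\
    forall t, W.[t] != 0 -> forall s,
    (forall p, V d p -> ('X - t%:P) ^+ s %| p -> p = 0) \/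
    (forall q, exists2 p, V d p & ('X - t%:P) ^+ s %| q - p).
  by move=> d; have [W] := jets d; exists W.
(* In degrees at least N the ideal contains all forms, so only the degrees
   below N constrain t. *)
have [t] : exists t, (\prod_(d < N) W d).[t] != 0.
  apply: exists_nonroot => //; rewrite prodf_seq_neq0.
  by apply/allP => d _; case: (HW d).
rewrite horner_prod prodf_seq_neq0 => /allP ht.
pose ell : {mpoly K[2]} := 'X_0 - t *: 'X_1.
have hell : ell \is 1.-homog by rewrite rpredB ?rpredZ // dhomogX /= mdeg1.
have Dell s : dehomogenize (ell ^+ s) = ('X - t%:P) ^+ s.
  rewrite dehomogenizeXn dehomogenizeB dehomogenizeZ !dehomogenizeX !mnm1E /=.
  by rewrite expr1 expr0 alg_polyC.
have hells i s F : F \is i.-homog -> ell ^+ s * F \is (i + s).-homog.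
  by move=> hF; rewrite addnC -{2}[s]mul1n dhomogM // dhomogMn.
apply: strong_lefschetz_homog_quotient (hell) _ => i s _.
have [le_N|lt_N] := leqP N (i + s)%N.
  right=> G hG; exists 0; rewrite ?rpred0 // mulr0 subr0; exact: artinian hG.
have {ht} /(proj2 (HW _)) : (W (i + s)%N).[t] != 0.
  exact: ht (Ordinal lt_N) (mem_index_enum _).
move=> /(_ s)[inj|surj]; [left=> F hF JF|right=> G hG].
  suff -> : F = 0 by rewrite rpred0.
  apply: (@dehomogenize_inj K i) => //; first by rewrite rpred0.
  rewrite [RHS]/dehomogenize mmap0; apply/eqP.
  have /inj : V (i + s)%N (dehomogenize (ell ^+ s * F)).
    by exists (ell ^+ s * F); rewrite hells.
  rewrite dehomogenizeM Dell dvdp_mulr // => /(_ isT)/eqP.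
  by rewrite mulf_eq0 expf_eq0 polyXsubC_eq0 andbF.
have [_ [F [hF JF <-]] dvd] := surj (dehomogenize G).
move: dvd; rewrite -dehomogenizeB; set E := G - F => /dvdpP[r Er].
have hE : E \is (i + s).-homog by rewrite rpredB.
have sr : (size r <= i.+1)%N.
  have [->|r0] := eqVneq r 0; first by rewrite size_poly0.
  have := size_dehomogenize hE; rewrite Er size_Mmonic ?monic_exp ?monicXsubC //.
  by rewrite size_exp_XsubC addnS /= -addSn leq_add2r.
exists (homogenize i r); first exact: homogenize_homog.
have -> : ell ^+ s * homogenize i r = E.
  apply: (@dehomogenize_inj K (i + s)) => //; first exact/hells/homogenize_homog.
  by rewrite dehomogenizeM Dell homogenizeK // Er mulrC.
by rewrite /E opprB addrC subrK.
Qed.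

(** * Ideals generated by linear forms *)

(** The linear form with coefficient vector a. *)
Definition linear_form (K : fieldType) (l : nat) (a : 'rV[K]_l) : {mpoly K[l]} :=
  \sum_i a 0 i *: 'X_i.

(** The ideal generated by the linear forms whose coefficient vectors are the
    rows of U. *)
Definition linear_ideal (K : fieldType) (m l : nat) (U : 'M[K]_(m, l)) :=
  gen_ideal (fun k => linear_form (row k U)).

(** Composition of p with a projector onto the common zero space of the rows of
    U.  On coefficient vectors it is right multiplication by the idempotent
    matrix 1 - pinvmx U *m U, whose kernel is the row space of U. *)
Definition restrict (K : fieldType) (m l : nat) (U : 'M[K]_(m, l))
    (p : {mpoly K[l]}) : {mpoly K[l]} :=
  p \mPo [tuple linear_form (row i (1%:M - pinvmx U *m U)) | i < l].

Section LinearIdeals.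
Variables (K : fieldType) (l : nat).
Implicit Types (p q : {mpoly K[l]}) (a b : 'rV[K]_l).

Lemma mcoeff_linear_form a i : (linear_form a)@_U_(i) = a 0 i.
Proof.
rewrite raddf_sum (bigD1 i) //= mcoeffZ mcoeffXU eqxx mulr1 big1 ?addr0 //.
by move=> j /negPf ne; rewrite mcoeffZ mcoeffXU ne mulr0.
Qed.

Lemma linear_form_eq0 a : (linear_form a == 0) = (a == 0).
Proof.
apply/eqP/eqP => [e|->]; last first.
  by rewrite /linear_form big1 // => i _; rewrite mxE scale0r.
by apply/rowP => i; rewrite -mcoeff_linear_form e mcoeff0 mxE.
Qed.

Lemma linear_formB a b : linear_form (a - b) = linear_form a - linear_form b.
Proof. by rewrite -sumrB; apply: eq_bigr => i _; rewrite !mxE scalerBl. Qed.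

Lemma linear_form_mulmx (m : nat) (c : 'rV[K]_m) (U : 'M[K]_(m, l)) :
  linear_form (c *m U) = \sum_k c 0 k *: linear_form (row k U).
Proof.
under [RHS]eq_bigr do rewrite scaler_sumr.
rewrite exchange_big; apply: eq_bigr => i _; rewrite mxE scaler_suml.
by apply: eq_bigr => k _; rewrite scalerA mxE.
Qed.

Lemma linear_form_delta (i : 'I_l) :
  linear_form (delta_mx 0 i : 'rV[K]_l) = 'X_i.
Proof.
rewrite /linear_form (bigD1 i) //= mxE !eqxx scale1r big1 ?addr0 //.
by move=> j /negPf ne; rewrite mxE ne andbF scale0r.
Qed.

Lemma linear_form_homog a : linear_form a \is 1.-homog.
Proof. by rewrite rpred_sum // => i _; rewrite rpredZ // dhomogX /= mdeg1. Qed.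

Lemma homog1_linear_form p : p \is 1.-homog -> p = linear_form (\row_i p@_U_(i)).
Proof.
move=> hp; apply/mpolyP => m; have [/mdeg1P[i /eqP ->]|m1] := boolP (mdeg m == 1%N).
  by rewrite mcoeff_linear_form mxE.
by rewrite !(dhomog_nemf_coeff _ m1) // linear_form_homog.
Qed.

Lemma meval_linear_form a (v : 'I_l -> K) :
  (linear_form a).@[v] = \sum_i a 0 i * v i.
Proof. by rewrite raddf_sum; apply: eq_bigr => i _; rewrite /= mevalZ mevalXU. Qed.

Variables (m : nat) (U : 'M[K]_(m, l)).

Lemma restrict_linear_form a :
  restrict U (linear_form a) = linear_form (a *m (1%:M - pinvmx U *m U)).
Proof.
rewrite linear_form_mulmx /restrict raddf_sum; apply: eq_bigr => i _ /=.
by rewrite comp_mpolyZ comp_mpolyXU -tnth_nth tnth_mktuple.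
Qed.

Lemma restrict_linear_form_eq0 a : (restrict U (linear_form a) == 0) = (a <= U)%MS.
Proof.
rewrite restrict_linear_form linear_form_eq0 mulmxBr mulmx1 subr_eq0 mulmxA.
apply/eqP/idP => [->|/mulmxKpV //]; exact: submxMl.
Qed.

Lemma restrictM p q : restrict U (p * q) = restrict U p * restrict U q.
Proof. exact: rmorphM. Qed.

Lemma to_quot_restrict p :
  to_quot (fun k => linear_form (row k U)) (restrict U p) =
  to_quot (fun k => linear_form (row k U)) p.
Proof.
set f := fun k => _; pose pi := to_quot f.
have piX i : pi (linear_form (row i (1%:M - pinvmx U *m U))) = pi 'X_i.
  apply/to_quot_eq; rewrite linearB /= row1 row_mul linear_formB linear_form_delta.
  rewrite addrAC subrr add0r rpredN linear_form_mulmx.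
  apply/gen_idealP; exists (fun k => (row i (pinvmx U) 0 k)%:MP).
  by apply: eq_bigr => k _; rewrite mul_mpolyC.
rewrite /restrict comp_mpolyE [in RHS](mpolyE p) !(raddf_sum (to_quot f)) /=.
apply: eq_bigr => n _; rewrite -!mul_mpolyC !rmorphM /= mpolyXE_id !rmorph_prod.
congr (_ * _); apply: eq_bigr => i _.
by rewrite !rmorphXn /= tnth_mktuple -/pi piX.
Qed.

(** The ideal of U is the kernel of an endomorphism of the polynomial ring.  It
    is therefore prime ([linear_ideal_prime]), as that ring is a domain. *)
Lemma linear_idealP p : reflect (restrict U p = 0) (p \in linear_ideal U).
Proof.
apply: (iffP idP) => [/gen_idealP[a ->]|e].
  rewrite /restrict raddf_sum big1 // => k _ /=.
  rewrite -/(restrict _ _) restrictM.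
  suff /eqP -> : restrict U (linear_form (row k U)) == 0.
    by rewrite mulr0.
  by rewrite restrict_linear_form_eq0 row_sub.
rewrite -[p]subr0 -e; apply/to_quot_eq; exact/esym/to_quot_restrict.
Qed.

Lemma linear_form_ideal a : (linear_form a \in linear_ideal U) = (a <= U)%MS.
Proof. by rewrite -restrict_linear_form_eq0; apply/linear_idealP/eqP. Qed.

Lemma linear_ideal_prime p q :
  (p * q \in linear_ideal U) = (p \in linear_ideal U) || (q \in linear_ideal U).
Proof.
apply/linear_idealP/orP => [/eqP|[] /linear_idealP e]; rewrite restrictM.
- by rewrite mulf_eq0 => /orP[] /eqP ?; [left|right]; apply/linear_idealP.
- by rewrite e mul0r.
- by rewrite e mulr0.
Qed.

Lemma linear_ideal_prod (I : eqType) (r : seq I) (P : pred I)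
    (F : I -> {mpoly K[l]}) :
  (forall i, i \in r -> P i -> F i \notin linear_ideal U) ->
  \prod_(i <- r | P i) F i \notin linear_ideal U.
Proof.
move=> H; rewrite big_seq_cond; elim/big_ind: _ => [|p q hp hq|i /andP[]].
- by apply/linear_idealP; rewrite /restrict rmorph1; apply/eqP/oner_neq0.
- by rewrite linear_ideal_prime negb_or hp.
- exact: H.
Qed.

End LinearIdeals.

Lemma linear_ideal1P (K : fieldType) (l : nat) (a : 'rV[K]_l) p :
  reflect (exists u, p = linear_form a * u) (p \in linear_ideal a).
Proof.
apply: (iffP (gen_idealP _ _)) => [[u ->]|[u ->]].
  by exists (u 0); rewrite big_ord1 row_id mulrC.
by exists (fun=> u); rewrite big_ord1 row_id mulrC.
Qed.

Lemma linear_ideal2P (K : fieldType) (l : nat) (a b : 'rV[K]_l) p :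
  reflect (exists u v, p = linear_form a * u + linear_form b * v)
    (p \in linear_ideal (col_mx a b)).
Proof.
apply: (iffP (gen_idealP _ _)) => [[u ->]|[u [v ->]]].
  exists (u (lshift _ 0)), (u (rshift _ 0)).
  by rewrite big_split_ord !big_ord1 /= rowKu rowKd !row_id ![linear_form _ * _]mulrC.
exists (fun k : 'I_(1 + 1) => if split k is inl _ then u else v).
rewrite big_split_ord !big_ord1 /= rowKu rowKd !row_id.
by rewrite (unsplitK (inl _)) (unsplitK (inr _)) ![linear_form _ * _]mulrC.
Qed.

(** * Derivations and the Jacobian ideal *)

(** Some power of z lies in the ideal generated by F and G. *)
Definition in_radical2 (R : comNzRingType) (F G z : R) : Prop :=
  exists n u v, z ^+ n = F * u + G * v.

Section Radical.
Variable R : comNzRingType.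
Implicit Types F G z : R.

Lemma in_radical2M F F' G z :
  in_radical2 F G z -> in_radical2 F' G z -> in_radical2 (F * F') G z.
Proof.
move=> [n [u [v e]]] [n' [u' [v' e']]].
exists (n + n')%N, (u * u'), (F * u * v' + v * (F' * u' + G * v')).
by rewrite exprD e e'; ring.
Qed.

Lemma in_radical2_prod (I : finType) (P : pred I) (F : I -> R) G z :
  (forall i, P i -> in_radical2 (F i) G z) ->
  in_radical2 (\prod_(i | P i) F i) G z.
Proof.
move=> H; elim/big_ind: _ => //; last by move=> *; apply: in_radical2M.
by exists 0%N, 1, 0; rewrite mulr1 mulr0 addr0.
Qed.

End Radical.

Section Derivations.
Variables (K : fieldType) (l : nat).
Local Notation S := {mpoly K[l]}.
Implicit Types (d e : 'rV[S]_l) (p q : S).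

Lemma der_applyM d p q : der_apply d (p * q) = der_apply d p * q + p * der_apply d q.
Proof.
rewrite /der_apply mulr_suml mulr_sumr -big_split; apply: eq_bigr => i _ /=.
by rewrite mderivM; ring.
Qed.

Lemma der_apply1 d : der_apply d 1 = 0.
Proof. by rewrite /der_apply big1 // => i _; rewrite mderivC mulr0. Qed.

Lemma der_applyD d e p : der_apply (d + e) p = der_apply d p + der_apply e p.
Proof. by rewrite -big_split; apply: eq_bigr => i _; rewrite mxE mulrDl. Qed.

Lemma der_applyZ q d p : der_apply (q *: d) p = q * der_apply d p.
Proof. by rewrite /der_apply mulr_sumr; apply: eq_bigr => i _; rewrite mxE mulrA. Qed.

Lemma der_applyB d e p : der_apply (d - e) p = der_apply d p - der_apply e p.
Proof. by rewrite der_applyD -scaleN1r der_applyZ mulN1r. Qed.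

Lemma mderiv_linear_form (a : 'rV[K]_l) i : (linear_form a)^`M(i) = (a 0 i)%:MP.
Proof.
rewrite /linear_form raddf_sum (bigD1 i) //= mderivZ mderivX mnm1E eqxx.
rewrite scale1r -[X in 'X_[X]](_ : 0%MM = _); last first.
  by apply/mnmP => j; rewrite mnmBE subnn mnm0E.
rewrite mpolyX0 big1 ?addr0 => [|j ne]; first by rewrite alg_mpolyC.
by rewrite mderivZ mderivX mnm1E (negPf ne) scale0r scaler0.
Qed.

Lemma der_apply_const_linear_form (w a : 'rV[K]_l) :
  der_apply (map_mx (@mpolyC l K) w) (linear_form a) = ((w *m a^T) 0 0)%:MP.
Proof.
rewrite mxE rmorph_sum; apply: eq_bigr => i _.
by rewrite !mxE mderiv_linear_form rmorphM.
Qed.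

End Derivations.

Local Notation form := Defs.form.

Section Arrangement.
Variables (K : fieldType) (charK0 : [pchar K] =i pred0).
Variables (l : nat) (A : arrangement K l).
Local Notation S := {mpoly K[l]}.
Local Notation Q := (defining_poly A).
Local Notation J := (gen_ideal (jacobian_gens A)).

(** The coefficient vector of the i-th linear form. *)
Definition normal (i : 'I_(num A)) : 'rV[K]_l := \row_j (form i)@_U_(j).

Lemma form_normal i : form i = linear_form (normal i).
Proof. exact/homog1_linear_form/form_linear. Qed.

Lemma mem_hypP i (v : 'rV[K]_l) : reflect (v *m (normal i)^T = 0) (v \in hyp i).
Proof.
have e : (form i).@[fun j => v 0 j] = (v *m (normal i)^T) 0 0.
  rewrite form_normal meval_linear_form [RHS]mxE.
  by apply: eq_bigr => j _; rewrite [in RHS]mxE mulrC.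
apply: (iffP idP) => [/form_zeros h|h].
  by apply/rowP => j; rewrite ord1 -e h mxE.
by apply/form_zeros; rewrite e h mxE.
Qed.

Lemma normal_neq0 i : normal i != 0.
Proof.
apply/eqP => n0; have := hyp_codim i.
have -> : hyp i = fullv.
  by apply/vspaceP => v; rewrite memvf; apply/mem_hypP; rewrite n0 trmx0 mulmx0.
by rewrite dimvf /dim /= mul1n => /eqP; rewrite eqn_leq ltnn.
Qed.

Lemma normal_subF i j : i != j -> ~~ (normal j <= normal i)%MS.
Proof.
apply: contra => /sub_rVP[c e]; apply/eqP/hyp_inj/vspaceP => v.
have c0 : c != 0 by apply: contraNneq (normal_neq0 j) => c0; rewrite e c0 scale0r.
have eP u : (u *m (normal j)^T == 0) = (u *m (normal i)^T == 0).
  by rewrite e linearZ /= -scalemxAr scaler_eq0 (negPf c0).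
by apply/mem_hypP/mem_hypP => /eqP h; apply/eqP; rewrite ?eP // -eP.
Qed.

Lemma rank_two_normals i j : i != j -> \rank (col_mx (normal i) (normal j)) = 2.
Proof.
move=> ne; apply/eqP; rewrite eqn_leq rank_leq_row /= -addsmxE.
suff : (normal i < normal i + normal j)%MS.
  by move/rank_ltmx; rewrite rank_rV normal_neq0.
rewrite /ltmx addsmxSl; apply: contra (normal_subF ne).
exact: submx_trans (addsmxSr _ _).
Qed.

Lemma jacobianP (p : S) :
  reflect (exists d g, p = der_apply d Q + Q * g) (p \in J).
Proof.
have sumE (a : option 'I_l -> S) :
    \sum_t a t * jacobian_gens A t = a None * Q + \sum_i a (Some i) * Q^`M(i).
  rewrite (bigD1 None) //=; congr (_ + _).
  rewrite (reindex_omap Some id) => [|[i|]] //=.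
  by apply: eq_bigl => i; rewrite eqxx.
apply: (iffP (gen_idealP _ _)) => [[a ->]|[d [g ->]]].
  exists (\row_i a (Some i)), (a None); rewrite sumE addrC mulrC; congr (_ + _).
  by apply: eq_bigr => i _; rewrite mxE.
by exists (fun t => if t is Some i then d 0 i else g); rewrite sumE addrC mulrC.
Qed.

Lemma defining_polyD1 i : Q = form i * \prod_(j < num A | j != i) form j.
Proof. exact: bigD1. Qed.

(** A constant derivation v with v(a_i) = c_i nonzero for every i, and the
    resulting expression of v(Q) modulo each a_i. *)
Lemma exists_generic_derivative : exists (v : 'rV[S]_l) (c : 'I_(num A) -> K) R,
  forall i, c i != 0 /\
  der_apply v Q = c i *: \prod_(j < num A | j != i) form j + form i * R i.
Proof.
have [i|w hw] := @exists_row_nonvanishing K charK0 l _ (fun i => (normal i)^T).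
  by rewrite trmx_eq0 normal_neq0.
exists (map_mx (@mpolyC l K) w), (fun i => (w *m (normal i)^T) 0 0).
exists (fun i => der_apply (map_mx (@mpolyC l K) w) (\prod_(j < num A | j != i) form j)).
move=> i; split.
  apply: contra (hw i) => /eqP e; apply/eqP/matrixP => a b.
  by rewrite !ord1 e mxE.
rewrite {1}(defining_polyD1 i) der_applyM {1}form_normal.
by rewrite der_apply_const_linear_form mul_mpolyC.
Qed.

(** As v(Q) is, modulo a_i, a unit times the product of the other forms, the
    relations between pairs of forms multiply up to Q and v(Q). *)
Lemma jacobian_in_radical (z : S) :
  (forall i j : 'I_(num A), i != j -> in_radical2 (form i : S) (form j : S) z) ->
  exists n, z ^+ n \in J.
Proof.
move=> Hz; have [v [c [R HP]]] := exists_generic_derivative.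
suff [n [u [w e]]] : in_radical2 Q (der_apply v Q) z.
  exists n; apply/jacobianP; exists (w *: v), u.
  by rewrite der_applyZ e addrC [w * _]mulrC.
apply: in_radical2_prod => i _; have [ci0 ->] := HP i.
have [|n [u [w e]]] := @in_radical2_prod _ _
    (fun j : 'I_(num A) => j != i) (fun j => form j) (form i) z.
  by move=> j ne; apply: Hz.
exists n, (w - (c i)^-1 *: (R i * u)), ((c i)^-1 *: u); rewrite e.
set T := \prod_(j < _ | _) _.
rewrite -!scalerAr mulrDl mulrBr -!scalerAl scalerDr scalerA mulVf // scale1r.
by rewrite -scalerAr mulrA; ring.
Qed.

(** The logarithmic derivations are those preserving the ideal of Q: by the
    Leibniz rule, a_i divides the product of d(a_i) with the other forms, and
    the ideal of a_i is prime. *)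
Lemma log_derP (d : 'rV[S]_l) :
  log_der A d <-> exists g, der_apply d Q = Q * g.
Proof.
split=> [H|[g e] i].
  rewrite /defining_poly; elim/big_ind: _ => //.
  - by exists 0; rewrite der_apply1 mulr0.
  - move=> p q [g e] [h e']; exists (g + h); rewrite der_applyM e e'; ring.
have ni : \prod_(j < num A | j != i) form j \notin linear_ideal (normal i).
  apply: linear_ideal_prod => j _ ne; rewrite form_normal linear_form_ideal.
  by rewrite normal_subF // eq_sym.
have : der_apply d (form i) * \prod_(j < num A | j != i) form j
    \in linear_ideal (normal i).
  apply/linear_ideal1P; exists ((\prod_(j < num A | j != i) form j) * g -
    der_apply d (\prod_(j < num A | j != i) form j)).
  move: e; rewrite (defining_polyD1 i) der_applyM -form_normal => /eqP.
  rewrite -subr_eq0 => /eqP e; apply/eqP; rewrite -subr_eq0 -[X in _ == X]e.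
  by apply/eqP; ring.
rewrite linear_ideal_prime (negPf ni) orbF form_normal.
by move/linear_ideal1P.
Qed.

End Arrangement.

(** * Regular elements on free modules *)

Section FreeSubmodule.
Variables (R : comNzRingType) (M : lmodType R) (N : M -> Prop).
Hypotheses (N0 : N 0) (ND : forall x y, N x -> N y -> N (x + y)).
Hypothesis NZ : forall (a : R) x, N x -> N (a *: x).
Hypothesis N_free : free_submodule N.

(** Finitely many elements of a free module have coordinates on a common finite
    independent family r, even if the chosen basis is infinite. *)
Lemma free_submodule_coords (k : nat) (x : 'I_k -> M) : (forall j, N (x j)) ->
  exists (r : seq M) (c : 'I_k -> M -> R),
  [/\ forall b, b \in r -> N b,
      forall j, x j = \sum_(b <- r) c j b *: b
    & forall a : M -> R, \sum_(b <- r) a b *: b = 0 -> forall b, b \in r -> a b = 0].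
Proof.
case: N_free => B [BN Bspan Bindep] Nx.
have /choice[f Hf] : forall j, exists f : seq (R * M),
    (forall y, y \in f -> B y.2) /\ x j = \sum_(y <- f) y.1 *: y.2.
  move=> j; have [n [b [c [Bb e]]]] := Bspan _ (Nx j).
  exists [seq (c i, b i) | i <- index_enum 'I_n]; split; last by rewrite big_map.
  by move=> _ /mapP[i _ ->]; apply: Bb.
pose r := undup (flatten [seq map snd (f j) | j <- enum 'I_k]).
have rB b : b \in r -> B b.
  rewrite mem_undup => /flatten_mapP[j _ /mapP[y hy ->]].
  by case: (Hf j) => H _; apply: H.
exists r, (fun j b => \sum_(y <- f j | y.2 == b) y.1); split.
- by move=> b /rB /BN.
- move=> j; have [_ ->] := Hf j.
  under [RHS]eq_bigr do rewrite scaler_suml.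
  rewrite (exchange_big_dep xpredT) //= big_seq [RHS]big_seq.
  apply: eq_bigr => y hy; have yr : y.2 \in r.
    rewrite mem_undup; apply/flatten_mapP; exists j; first by rewrite mem_enum.
    exact: map_f.
  rewrite (eq_bigl (fun b => b == y.2)) => [|b]; last by rewrite eq_sym.
  by rewrite -big_filter filter_pred1_uniq ?undup_uniq // big_seq1.
- move=> a e b br; pose t := in_tuple r.
  have inj : injective (tnth t) by apply/tuple_uniqP; rewrite undup_uniq.
  have [i ->] := tnthP t b br.
  apply: (Bindep _ (tnth t) (fun i => a (tnth t i)) inj).
    by move=> i'; apply: rB; apply: mem_tnth.
  by rewrite -[RHS]e [RHS](big_tnth _ _ r).
Qed.

(** If p is a nonzerodivisor modulo (q, h) on the ring, then it is one on every
    free module. *)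
Lemma free_submodule_regular (p q h : R) :
  (forall g u v, p * g = q * u + h * v -> exists u' v', g = q * u' + h * v') ->
  forall x y z, N x -> N y -> N z -> p *: x = q *: y + h *: z ->
  exists y' z', [/\ N y', N z' & x = q *: y' + h *: z'].
Proof.
move=> regular x y z Nx Ny Nz e.
have [j|r [c [rN cE indep]]] := @free_submodule_coords 3 (tnth [tuple x; y; z]).
  by case: j => -[|[|[|]]] //= ?; rewrite (tnth_nth 0).
move: (cE 0) (cE 1) (cE 2); rewrite !(tnth_nth 0) /= => xE yE zE.
have cr b : b \in r -> p * c 0 b = q * c 1 b + h * c 2 b.
  move=> br; apply/eqP; rewrite -subr_eq0; apply/eqP.
  apply: (indep (fun b => p * c 0 b - (q * c 1 b + h * c 2 b))) => //.
  move/eqP: e; rewrite -subr_eq0 {}xE {}yE {}zE => /eqP e; rewrite -[RHS]e.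
  rewrite !scaler_sumr -big_split -sumrB; apply: eq_bigr => b' _ /=.
  by rewrite scalerBl scalerDl !scalerA.
have /choice[u Hu] : forall b, exists u : R * R,
    b \in r -> c 0 b = q * u.1 + h * u.2.
  move=> b; have [br|] := boolP (b \in r); last by exists (0, 0).
  by have [u [v]] := regular _ _ _ (cr _ br); exists (u, v).
have Nsum (a : M -> R) : N (\sum_(b <- r) a b *: b).
  by rewrite big_seq; elim/big_ind: _ => // b /rN; apply: NZ.
exists (\sum_(b <- r) (u b).1 *: b), (\sum_(b <- r) (u b).2 *: b).
split; [exact: Nsum | exact: Nsum | rewrite xE !scaler_sumr -big_split].
rewrite big_seq [RHS]big_seq; apply: eq_bigr => b /Hu ->.
by rewrite /= scalerDl !scalerA.
Qed.

End FreeSubmodule.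

(** * A linear form that is regular modulo the Jacobian ideal *)

Section NonZeroDivisor.
Variables (K : fieldType) (charK0 : [pchar K] =i pred0).
Variables (l : nat) (A : arrangement K l) (w : 'rV[K]_l).
Hypothesis w_generic :
  forall i j : 'I_(num A), ~~ (w <= col_mx (normal i) (normal j))%MS.
Local Notation S := {mpoly K[l]}.
Local Notation Q := (defining_poly A).
Local Notation ell := (linear_form w).

Lemma normal_notin_pair (i j : 'I_(num A)) :
  i != j -> ~~ (normal j <= col_mx w (normal i))%MS.
Proof.
move=> ne; apply/negP; rewrite -addsmxE => /sub_addsmxP[[x y] /= e].
have {x y e} [x [y e]] : exists x y, normal j = x *: w + y *: normal i.
  exists (x 0 0), (y 0 0).
  by rewrite {}e [x]mx11_scalar [y]mx11_scalar !mul_scalar_mx !mxE.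
have [x0|x0] := eqVneq x 0.
  by case/negP: (normal_subF ne); rewrite e x0 scale0r add0r scalemx_sub.
case/negP: (w_generic i j).
have -> : w = x^-1 *: (normal j - y *: normal i).
  by rewrite e addrK scalerA mulVf // scale1r.
rewrite scalemx_sub // addmx_sub ?eqmx_opp ?scalemx_sub //;
 by rewrite -addsmxE ?addsmxSl ?addsmxSr.
Qed.

(** The form ell generates a prime ideal, which does not contain Q. *)
Lemma ell_dvd (p q : S) : ell * p = Q * q -> exists q', q = ell * q'.
Proof.
move=> e; apply/linear_ideal1P; have : Q * q \in linear_ideal w.
  by rewrite -e; apply/linear_ideal1P; exists p.
rewrite linear_ideal_prime => /orP[|//]; apply: contraLR => _.
apply: linear_ideal_prod => i _ _; rewrite form_normal linear_form_ideal.
apply/sub_rVP => -[c e'].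
have c0 : c != 0 by apply: contraNneq (normal_neq0 i) => c0; rewrite e' c0 scale0r.
case/negP: (w_generic i i); have -> : w = c^-1 *: normal i.
  by rewrite e' scalerA mulVf // scale1r.
by rewrite scalemx_sub // -addsmxE addsmxSl.
Qed.

(** P is a nonzerodivisor modulo (ell, Q): one proves that g lies in (ell, T)
    for every partial product T of the a_i, adding one factor at a time. *)
Lemma derivative_regular (P : S) (c : 'I_(num A) -> K) R :
  (forall i, c i != 0 /\
     P = c i *: \prod_(j < num A | j != i) form j + form i * R i) ->
  forall g u v, P * g = Q * u + ell * v -> exists u' v', g = Q * u' + ell * v'.
Proof.
move=> HP g u v e.
have P_notin (i : 'I_(num A)) : P \notin linear_ideal (col_mx w (normal i)).
  have [ci0 ->] := HP i; apply/negP => h.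
  have /negP[] : \prod_(j < num A | j != i) form j
      \notin linear_ideal (col_mx w (normal i)).
    apply: linear_ideal_prod => j _ ne.
    by rewrite form_normal linear_form_ideal normal_notin_pair // eq_sym.
  rewrite -[X in X \in _]scale1r -(mulVf ci0) -scalerA -mul_mpolyC gen_idealMl //.
  rewrite -[X in X \in _](addrK (form i * R i)) rpredB // gen_idealMr //.
  by rewrite form_normal linear_form_ideal -addsmxE addsmxSr.
suff H (r : seq 'I_(num A)) : uniq r ->
    exists u' v', g = (\prod_(i <- r) form i) * u' + ell * v'.
  exact/H/index_enum_uniq.
(* If g = T x + ell y, then P T x lies in the prime ideal (ell, a_i), which
   contains neither P nor T, so x lies in it. *)
elim: r => [_|i r IH /= /andP[ir /IH[x [y gE]]]].
  by exists g, 0; rewrite big_nil mul1r mulr0 addr0.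
rewrite big_cons; set T := \prod_(j <- r) _ in gE *.
suff /linear_ideal2P[x1 [x2 xE]] : x \in linear_ideal (col_mx w (normal i)).
  by exists x2, (T * x1 + y); rewrite gE xE -form_normal; ring.
have : P * (T * x) \in linear_ideal (col_mx w (normal i)).
  apply/linear_ideal2P.
  exists (v - P * y), ((\prod_(j < num A | j != i) form j) * u).
  rewrite -form_normal [form i * _]mulrA -defining_polyD1.
  have -> : P * (T * x) = P * g - P * (ell * y) by rewrite gE; ring.
  by rewrite e; ring.
rewrite mulrA linear_ideal_prime => /orP[|//].
rewrite linear_ideal_prime (negPf (P_notin i)).
apply: contraLR => _; apply: linear_ideal_prod => j jr _.
rewrite form_normal linear_form_ideal normal_notin_pair //.
by apply: contraNneq ir => ->.
Qed.

End NonZeroDivisor.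

Section FreeArrangement.
Variables (K : fieldType) (charK0 : [pchar K] =i pred0).
Variables (l : nat) (A : arrangement K l).
Local Notation S := {mpoly K[l]}.
Local Notation Q := (defining_poly A).
Local Notation J := (gen_ideal (jacobian_gens A)).

Lemma jacobian_regular (w : 'rV[K]_l) : free_arrangement A -> w != 0 ->
  (forall i j : 'I_(num A), ~~ (w <= col_mx (normal i) (normal j))%MS) ->
  forall f : S, linear_form w * f \in J -> f \in J.
Proof.
move=> A_free w0 w_generic f /jacobianP[a [g efE]].
have [v [c [R HP]]] := exists_generic_derivative charK0 A.
set P := der_apply v Q in HP; set ell := linear_form w in efE *.
have ell0 : ell != 0 by rewrite linear_form_eq0.
have aE : der_apply a Q = ell * f - Q * g by rewrite efE addrK.
have N0 : log_der A 0.
  by apply/log_derP; exists 0; rewrite -(scale0r a) der_applyZ mul0r mulr0.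
have ND x y : log_der A x -> log_der A y -> log_der A (x + y).
  move=> /log_derP[p ep] /log_derP[q eq]; apply/log_derP; exists (p + q).
  by rewrite der_applyD ep eq mulrDr.
have NZ p x : log_der A x -> log_der A (p *: x).
  move=> /log_derP[q eq]; apply/log_derP; exists (p * q).
  by rewrite der_applyZ eq mulrCA.
have Nx : log_der A (Q *: a).
  by apply/log_derP; exists (der_apply a Q); rewrite der_applyZ.
have Ny : log_der A (P *: a - (ell * f) *: v).
  apply/log_derP; exists (- (P * g)).
  by rewrite der_applyB !der_applyZ -/P aE; ring.
have Nz : log_der A ((Q * f) *: v).
  by apply/log_derP; exists (f * P); rewrite der_applyZ mulrA.
(* The syzygy on which freeness is used. *)
have eqn : P *: (Q *: a) =
    Q *: (P *: a - (ell * f) *: v) + ell *: ((Q * f) *: v).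
  rewrite scalerBr !scalerA [P * Q]mulrC -addrA.
  by rewrite [Q * (ell * f)]mulrCA addNr addr0.
have [y [z [Ny' _ xE]]] := free_submodule_regular N0 ND NZ A_free
  (derivative_regular w_generic HP) Nx Ny Nz eqn.
have {Ny'} /log_derP[h hE] := Ny'.
have /choice[c' c'E] : forall j, exists q, a 0 j - y 0 j = ell * q.
  move=> j; apply: (ell_dvd w_generic (p := z 0 j)).
  by move/rowP/(_ j): xE; rewrite !mxE mulrBr => ->; rewrite addrAC subrr add0r.
(* Coordinatewise, a - y is divisible by ell, so the derivation a may be
   replaced by a multiple of ell modulo logarithmic derivations. *)
have aE' : a = y + ell *: \row_j c' j.
  by apply/rowP => j; rewrite !mxE -c'E addrC subrK.
set c0 := \row_j c' j in aE'.
have fE : ell * (f - der_apply c0 Q) = Q * (h + g).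
  by rewrite mulrBr efE aE' der_applyD der_applyZ hE; ring.
have [q qE] := ell_dvd w_generic fE.
apply/jacobianP; exists c0, q; apply: (mulfI ell0).
by rewrite mulrDr mulrCA -qE -fE -mulrDr addrC subrK.
Qed.

End FreeArrangement.

(** * The strong Lefschetz property for free arrangements *)

Theorem theorem8p3 (K : fieldType) (charK0 : [pchar K]%R =i pred0)
    (l : nat) (A : arrangement K l) :
  free_arrangement A -> strong_lefschetz (jacobian_quotient A).
Proof.
move=> A_free; have [l_ge3|] := ltnP 2 l.
  (* The index None excludes the zero form, which matters only for the empty
     arrangement. *)
  pose U (o : option ('I_(num A) * 'I_(num A))) : 'M[K]_(2, l) :=
    if o is Some (i, j) then col_mx (normal i) (normal j) else 0.
  have [w hw] := @exists_row_notin K charK0 l 2 _ U l_ge3.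
  have regular : forall f, linear_form w * f \in gen_ideal (jacobian_gens A) ->
      f \in gen_ideal (jacobian_gens A).
    apply: jacobian_regular => //.
      by apply: contraNneq (hw None) => ->; apply: sub0mx.
    by move=> i j; apply: (hw (Some (i, j))).
  apply: (@strong_lefschetz_homog_quotient _ _ _ _ _ _ (linear_form_homog w)).
  move=> i s _; left=> F _; elim: s F => [|s IH] F; first by rewrite mul1r.
  by rewrite exprS -mulrA => /regular /IH.
have span (i j : 'I_(num A)) : i != j -> (1 < l)%N /\
    ((l <= 2)%N -> row_full (col_mx (normal i) (normal j))).
  move=> ne; have r2 := rank_two_normals ne.
  have := rank_leq_col (col_mx (normal i) (normal j)); rewrite r2 => ge2.
  by split=> [|le2]; rewrite /row_full ?r2 ?eqn_leq ?le2 ?andbT; exact: ge2.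
(* For l <= 1 there are no two distinct hyperplanes, so the power of z = 1
   lies in J and the quotient is zero. *)
case: l A A_free span => [|[|[|//]]] A _ span _.
1,2: have [|n] := @jacobian_in_radical K charK0 _ A 1;
  [by move=> i j /span[] | rewrite expr1n => J1].
1,2: apply: (@strong_lefschetz_homog_quotient _ _ _ _ _ 0 (rpred0 _)) => i s _;
  left=> F _ _; rewrite -[F]mulr1; exact: gen_idealMl.
have powX (k : 'I_2) : exists n, 'X_k ^+ n \in gen_ideal (jacobian_gens A).
  apply: jacobian_in_radical => // i j /span[_ /(_ isT) full].
  have /linear_ideal2P[u [v e]] : 'X_k \in linear_ideal (col_mx (normal i) (normal j)).
    by rewrite -linear_form_delta linear_form_ideal submx_full.
  by exists 1%N, u, v; rewrite expr1 !form_normal.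
have [[a Ja] [b Jb]] := (powX ord0, powX (lift ord0 ord0)).
apply: (@strong_lefschetz_binary_forms K charK0 _ _ _ (a + b)%N) => d F ab_d hF.
rewrite [F]mpolyE big_seq rpred_sum // => m hm.
rewrite -mul_mpolyC gen_idealMl // mpolyXE_id big_ord_recl big_ord1.
have := dhomog2_mdeg hF hm.
have [le_a _|lt_a md] := leqP a (m ord0).
  by rewrite gen_idealMr // -(subnKC le_a) exprD gen_idealMr.
have le_b : (b <= m (lift ord0 ord0))%N.
  rewrite leqNgt; apply/negP => lt_b; move: ab_d.
  by rewrite -md leqNgt -addnS leq_add // ltnW.
by rewrite gen_idealMl // -(subnKC le_b) exprD gen_idealMr.
Qed.
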